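(* Let $B\wr\mathcal{H}(d)$, $\chi=(\chi(S),\chi(R))$, $\widetilde{\mathcal{H}}=\widetilde{\mathcal{H}}^\chi_d$ and $(M,\sigma^M,\rho^M)$ be as in the context; in particular $S$ and $R$ act on $M\otimes M$ as multiplication by the scalars $\chi(S),\chi(R)\in K$. Then $(M,\sigma^M,\rho^M)$ is a ground module if and only if the following hold: (i) for all $1\le i\le d-1$, all $b\in B^{\otimes d}$ and all $m\in M^{\otimes d}$: (M2) $\sigma^M_i(b\cdot m)=\sigma_i(b)\cdot\sigma^M_i(m)$ and $\rho^M_i(b\cdot m)=\sigma_i(b)\cdot\rho^M_i(m)+\rho_i(b)\cdot m$; (M4) $\chi(S)(\sigma^M_i)^2+\rho^M_i\sigma^M_i+\sigma^M_i\rho^M_i=l^M_{S_i}\sigma^M_i$ and $\chi(R)(\sigma^M_i)^2+(\rho^M_i)^2=l^M_{S_i}\rho^M_i+l^M_{R_i}$; (ii) if $d\ge 3$, additionally for all $i,j$ with $|i-j|=1$: (M5) $\sigma^M_i\sigma^M_j\sigma^M_i=\sigma^M_j\sigma^M_i\sigma^M_j$ and $\rho^M_i\sigma^M_j\sigma^M_i=\sigma^M_j\sigma^M_i\rho^M_j$; (M6) $\rho^M_i\sigma^M_j\rho^M_i=\chi(S)\,\sigma^M_j\rho^M_i\sigma^M_j+\rho^M_j\rho^M_i\sigma^M_j+\sigma^M_j\rho^M_i\rho^M_j$; (M7) $\rho^M_i\rho^M_j\rho^M_i+\chi(R)\,\sigma^M_i\rho^M_j\sigma^M_i=\rho^M_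j\rho^M_i\rho^M_j+\chi(R)\,\sigma^M_j\rho^M_i\sigma^M_j$.
   Context: Let $K$ be a commutative ring and $B$ a unital associative $K$-algebra, free as a $K$-module; all tensor products are over $K$. Fix $d\ge 2$, elements $S,R\in B\otimes B$ and $K$-linear maps $\sigma,\rho:B\otimes B\to B\otimes B$. For $Z\in B\otimes B$ and $1\le i\le d-1$ put $Z_i:=1^{\otimes(i-1)}\otimes Z\otimes 1^{\otimes(d-i-1)}\in B^{\otimes d}$; for $\phi\in\mathrm{End}_K(B\otimes B)$ let $\phi_i\in\mathrm{End}_K(B^{\otimes d})$ be $\phi$ applied to tensor factors $i,i+1$. The quantum wreath product $B\wr\mathcal{H}(d)$ is the unital $K$-algebra generated by the algebra $B^{\otimes d}$ and elements $H_1,\dots,H_{d-1}$ subject to $H_kH_{k+1}H_k=H_{k+1}H_kH_{k+1}$, $H_iH_j=H_jH_i$ for $|i-j|\ge2$, $H_i^2=S_iH_i+R_i$, and $H_ib=\sigma_i(b)H_i+\rho_i(b)$ for $b\in B^{\otimes d}$. For $w\in\Sigma_d$ with reduced expression $s_{i_1}\cdots s_{i_N}$ ($s_i=(i,i+1)$) put $H_w:=H_{i_1}\cdots H_{i_N}$. Standing assumption: $B\wr\mathcal{H}(d)$ has a PBW basis: for a $K$-basis $\{b_j\}$ of $B$, the elements $(b_{j_1}\otimes\cdots\otimes b_{j_d})H_w$, $w\in\Sigma_d$, form a $K$-basis; so each element is uniquely $\sum_w b_wH_w$ with $b_w\in B^{\otimes d}$. Fix $\chi(S),\chi(R)\in K$.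 The twisted Hecke algebra $\widetilde{\mathcal{H}}=\widetilde{\mathcal{H}}^\chi_d$ is the $K$-algebra generated by $h_1,\dots,h_{d-1}$ subject to the type A braid relations and $h_i^2=\chi(S)h_i+\chi(R)$; it has $K$-basis $\{h_w\}_{w\in\Sigma_d}$. Let $M$ be a left $B$-module such that $S$ and $R$ act on the $B\otimes B$-module $M\otimes M$ as multiplication by $\chi(S)$ and $\chi(R)$, and fix $\sigma^M,\rho^M\in\mathrm{End}_K(M\otimes M)$. Let $\sigma^M_i,\rho^M_i\in\mathrm{End}_K(M^{\otimes d})$ be these maps on tensor factors $i,i+1$; for $X\in B^{\otimes d}$, $l^M_X\in\mathrm{End}_K(M^{\otimes d})$ is the (factorwise) action of $X$. Let $K\Sigma_d$ denote the free $K$-module with basis $\Sigma_d$. A choice map $r$ assigns to each $w\in\Sigma_d$ a reduced expression $r(w)$, with $r(1)$ empty, such that for $w\ne1$, $r(w)=s_ir(x)$ for some $i$ with $x=s_iw$, $\ell(x)=\ell(w)-1$. The structure map $\tau^M=\tau^M(r):K\Sigma_d\otimes M^{\otimes d}\to M^{\otimes d}\otimes\widetilde{\mathcal{H}}$ is defined recursively by $\tau^M(1\otimes m)=m\otimes1$, $\tau^M(s_i\otimes m)=\sigma^M_i(m)\otimes h_i+\rho^M_i(m)\otimes1$, and, if $r(w)=s_ir(x)$ and $\tau^M(x\otimes m)=\sum_y m_y\otimes h_y$, then $\tau^M(w\otimes m)=\sum_y\big(\sigma^M_i(m_y)\otimes h_ih_y+\rho^M_i(m_y)\otimes h_y\big)$.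 The triple $(M,\sigma^M,\rho^M)$ (with twist $\chi$) is a ground module if (i) $\tau^M(r)$ is independent of the choice map $r$, and (ii) for all $w,x\in\Sigma_d$, $b\in B^{\otimes d}$, $m\in M^{\otimes d}$: writing $H_wb=\sum_g b_gH_g$ ($b_g\in B^{\otimes d}$) one has $\tau^M(w\otimes b\cdot m)=\sum_g(b_g\otimes1)\cdot\tau^M(g\otimes m)$; and writing $H_wH_x=\sum_g c_gH_g$ ($c_g\in B^{\otimes d}$) and $\tau^M(x\otimes m)=\sum_y m_y\otimes h_y$, one has $\sum_g(c_g\otimes1)\cdot\tau^M(g\otimes m)=\sum_y\tau^M(w\otimes m_y)(1\otimes h_y)$. Here $B^{\otimes d}$ acts on $M^{\otimes d}\otimes\widetilde{\mathcal{H}}$ via the first factor and $(1\otimes h)$ denotes right multiplication on the $\widetilde{\mathcal{H}}$ factor. *)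

(* Defs.v *)
From HB Require Import structures.
From mathcomp Require Import all_boot all_order all_algebra all_fingroup.
From Stdlib Require Import ClassicalEpsilon.
Set Implicit Arguments. Unset Strict Implicit. Unset Printing Implicit Defensive.
Import GRing.Theory.
Local Open Scope ring_scope.

Section QWP.
Variable K : comPzRingType.

Definition klinear (U W : lmodType K) (g : U -> W) : Prop :=
  forall (a : K) (u v : U), g (a *: u + v) = a *: g u + g v.

Definition upd (n : nat) (V : Type) (v : 'I_n -> V) (k : 'I_n) (x : V) : 'I_n -> V :=
  fun l => if l == k then x else v l.

Definition multilinear (n : nat) (V W : lmodType K) (f : ('I_n -> V) -> W) : Prop :=
  forall (v : 'I_n -> V) (k : 'I_n), klinear (fun x : V => f (upd v k x)).

Definition is_tensor_power (n : nat) (V T : lmodType K) (t : ('I_n -> V) -> T) : Prop :=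
  multilinear t /\
  forall (W : lmodType K) (f : ('I_n -> V) -> W), multilinear f ->
    exists g : T -> W, [/\ klinear g, (forall v, g (t v) = f v) &
      forall g' : T -> W, klinear g' -> (forall v, g' (t v) = f v) -> g' =1 g].

(** the linear map T -> W induced by a multilinear f (chosen by the universal
    property; meaningful when (T,t) is a tensor power and f is multilinear) *)
Definition tlift (n : nat) (V T W : lmodType K) (t : ('I_n -> V) -> T)
  (f : ('I_n -> V) -> W) : T -> W :=
  epsilon (inhabits (fun _ : T => (0 : W)))
    (fun g => klinear g /\ forall v, g (t v) = f v).

Definition tact (n : nat) (A V TA TV : lmodType K) (tA : ('I_n -> A) -> TA)
  (tV : ('I_n -> V) -> TV) (act : A -> V -> V) (x : TA) (m : TV) : TV :=
  tlift tA (fun a => tlift tV (fun v => tV (fun k => act (a k) (v k))) m) x.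

Definition free_module (V : lmodType K) : Prop :=
  exists (I : eqType) (e : I -> V),
    (forall v : V, exists (s : seq I) (c : I -> K), v = \sum_(i <- s) c i *: e i) /\
    (forall (s : seq I) (c : I -> K), uniq s -> \sum_(i <- s) c i *: e i = 0 ->
        forall i, i \in s -> c i = 0).

Definition left_module (B : algType K) (M : lmodType K) (act : B -> M -> M) : Prop :=
  [/\ forall m, act 1 m = m,
      forall a b m, act (a * b) m = act a (act b m),
      forall a b m, act (a + b) m = act a m + act b m,
      forall a m n, act a (m + n) = act a m + act a n &
      forall (k : K) m, act (k%:A) m = k *: m].

Section Degree.
Variable d : nat.

(** indices i : 'I_d.-1 are the 0-based versions of 1 <= i <= d-1;
    s_ i swaps the (0-based) tensor positions i and i+1 *)
Lemma pos1_proof (i : 'I_d.-1) : (i.+1 < d)%N.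
Proof. by case: d i => [|d'] [i hi]. Qed.

Definition pos0 (i : 'I_d.-1) : 'I_d := widen_ord (leq_pred d) i.
Definition pos1 (i : 'I_d.-1) : 'I_d := Ordinal (pos1_proof i).
Definition s_ (i : 'I_d.-1) : 'S_d := tperm (pos0 i) (pos1 i).

Definition upd2 (V : Type) (m : 'I_d -> V) (i : 'I_d.-1) (p : 'I_2 -> V) : 'I_d -> V :=
  fun k => if k == pos0 i then p ord0 else if k == pos1 i then p ord_max else m k.
Definition pick2 (V : Type) (m : 'I_d -> V) (i : 'I_d.-1) : 'I_2 -> V :=
  fun k => if k == ord0 then m (pos0 i) else m (pos1 i).

Definition tins (V T T2 : lmodType K) (t : ('I_d -> V) -> T) (t2 : ('I_2 -> V) -> T2)
  (m : 'I_d -> V) (i : 'I_d.-1) : T2 -> T :=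
  tlift t2 (fun p => t (upd2 m i p)).

Definition onf (V T T2 : lmodType K) (t : ('I_d -> V) -> T) (t2 : ('I_2 -> V) -> T2)
  (phi : T2 -> T2) (i : 'I_d.-1) : T -> T :=
  tlift t (fun m => tins t t2 m i (phi (t2 (pick2 m i)))).

Definition elt_i (B : algType K) (T T2 : lmodType K) (t : ('I_d -> B) -> T)
  (t2 : ('I_2 -> B) -> T2) (Z : T2) (i : 'I_d.-1) : T :=
  tins t t2 (fun _ => 1) i Z.

Definition wprod (s : seq 'I_d.-1) : 'S_d := foldr (fun i w => (s_ i * w)%g) 1%g s.
Definition reduced (w : 'S_d) (s : seq 'I_d.-1) : Prop :=
  wprod s = w /\ forall s', wprod s' = w -> (size s <= size s')%N.
Definition rword (w : 'S_d) : seq 'I_d.-1 := epsilon (inhabits [::]) (reduced w).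
Definition gword (R : algType K) (g : 'I_d.-1 -> R) (w : 'S_d) : R :=
  foldr (fun i a => g i * a) 1 (rword w).

Definition choice_map (r : 'S_d -> seq 'I_d.-1) : Prop :=
  r 1%g = [::] /\
  forall w, reduced w (r w) /\ (w != 1%g -> exists i, r w = i :: r (s_ i * w)%g).

(** The quantum wreath product: A with B^{(x)d} -> A (algebra map j) and H_i,
    satisfying the defining relations, with the PBW basis property. *)
Definition wreath_product (B : algType K) (TB TB2 : lmodType K)
  (tB : ('I_d -> B) -> TB) (tB2 : ('I_2 -> B) -> TB2) (S R : TB2)
  (sigma rho : TB2 -> TB2) (A : algType K) (j : TB -> A) (H : 'I_d.-1 -> A) : Prop :=
  [/\ klinear j /\ j (tB (fun _ => 1)) = 1 /\
        (forall b c, j (tB b) * j (tB c) = j (tB (fun k => b k * c k))),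
      (forall i k : 'I_d.-1, val k = i.+1 -> H i * H k * H i = H k * H i * H k) /\
        (forall i k : 'I_d.-1, (i.+1 < k)%N -> H i * H k = H k * H i),
      (forall i, H i * H i = j (elt_i tB tB2 S i) * H i + j (elt_i tB tB2 R i)),
      (forall i (b : TB), H i * j b = j (onf tB tB2 sigma i b) * H i + j (onf tB tB2 rho i b)) &
      bijective (fun f : {ffun 'S_d -> TB} => \sum_w j (f w) * gword H w)].

Definition twisted_hecke (chiS chiR : K) (Ht : algType K) (h : 'I_d.-1 -> Ht) : Prop :=
  [/\ (forall i k : 'I_d.-1, val k = i.+1 -> h i * h k * h i = h k * h i * h k),
      (forall i k : 'I_d.-1, (i.+1 < k)%N -> h i * h k = h k * h i),
      (forall i, h i * h i = chiS *: h i + chiR%:A) &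
      bijective (fun c : {ffun 'S_d -> K} => \sum_w c w *: gword h w)].

Definition coordH (Ht : algType K) (h : 'I_d.-1 -> Ht) (x : Ht) : {ffun 'S_d -> K} :=
  epsilon (inhabits [ffun _ => 0]) (fun c => \sum_w c w *: gword h w = x).

Definition pbw_coord (TB : lmodType K) (A : algType K) (j : TB -> A) (H : 'I_d.-1 -> A)
  (a : A) : {ffun 'S_d -> TB} :=
  epsilon (inhabits [ffun _ => 0]) (fun f => \sum_w j (f w) * gword H w = a).

(** Elements of M^{(x)d} (x) Ht are represented as {ffun 'S_d -> TM}
    (F represents sum_y F y (x) h_y). *)
Section Tau.
Variables (TM : lmodType K) (Ht : algType K) (h : 'I_d.-1 -> Ht).
Variables (sM rM : 'I_d.-1 -> TM -> TM).

Definition Tstep (i : 'I_d.-1) (F : {ffun 'S_d -> TM}) : {ffun 'S_d -> TM} :=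
  [ffun g => \sum_y coordH h (h i * gword h y) g *: sM i (F y) + rM i (F g)].

Definition tau (r : 'S_d -> seq 'I_d.-1) (w : 'S_d) (m : TM) : {ffun 'S_d -> TM} :=
  foldr Tstep [ffun g => if g == 1%g then m else 0] (r w).

Definition rmulH (F : {ffun 'S_d -> TM}) (x : Ht) : {ffun 'S_d -> TM} :=
  [ffun g => \sum_v coordH h (gword h v * x) g *: F v].
End Tau.

Definition ground_module (TB TM : lmodType K) (A : algType K) (j : TB -> A)
  (H : 'I_d.-1 -> A) (actB : TB -> TM -> TM) (Ht : algType K) (h : 'I_d.-1 -> Ht)
  (sM rM : 'I_d.-1 -> TM -> TM) : Prop :=
  (forall r r', choice_map r -> choice_map r' ->
     forall w m, tau h sM rM r w m = tau h sM rM r' w m) /\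
  (forall r, choice_map r -> forall (w x : 'S_d) (b : TB) (m : TM),
     tau h sM rM r w (actB b m) =
       [ffun y => \sum_g actB (pbw_coord j H (gword H w * j b) g) (tau h sM rM r g m y)]
     /\
     [ffun y => \sum_g actB (pbw_coord j H (gword H w * gword H x) g) (tau h sM rM r g m y)]
       = [ffun y => \sum_v rmulH h (tau h sM rM r w (tau h sM rM r x m v)) (gword h v) y]).

End Degree.
End QWP.

(* Main.v *)
Require Import Defs.
From HB Require Import structures.
From mathcomp Require Import all_boot all_order all_algebra all_fingroup.
From mathcomp Require Import zify.
From Stdlib Require Import ClassicalEpsilon FunctionalExtensionality.
Import GRing.Theory.
Local Open Scope ring_scope.
Set Implicit Arguments. Unset Strict Implicit. Unset Printing Implicit Defensive.

(** On [N = TM (x) Ht] let [T_i (m (x) x) = sM_i m (x) h_i x + rM_i m (x) x]; this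
    operator commutes with right multiplication by [Ht], and [tau r w m] is the product of
    the [T_i] along [r w] applied to [m (x) 1].  Comparing coefficients of the basis of
    [Ht], (M2) says [T_i b = sig_i b T_i + rh_i b], (M4) says [T_i^2 = S_i T_i + R_i], and
    (M5)-(M7) say [T_i T_k T_i = T_k T_i T_k]; distant [T_i] commute automatically, since
    they act on disjoint tensor factors.  So a ground module yields (M2)-(M7) by taking
    [w, x] in [{1, s_i}] and two choice maps that differ on [s_i s_k s_i].  Conversely, with
    Matsumoto's theorem these relations turn [sum_w b_w H_w |-> sum_w b_w T_w] into a
    representation of the wreath product on [N], and multiplicativity of this
    representation is the ground module property. *)

(** * Reduced words in the symmetric group *)
Section Words.
Variable d : nat.
Implicit Types (w : 'S_d) (i k : 'I_d.-1) (s : seq 'I_d.-1).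
Local Open Scope nat_scope.

Definition inversions w : {set 'I_d * 'I_d} :=
  [set p : 'I_d * 'I_d | (p.1 < p.2) && (w p.2 < w p.1)].
(** Coxeter length: by [reducedP], minimality of a word becomes the equation [size s = ninv w],
    which suits induction better than quantifying over all words. *)
Definition ninv w : nat := #|inversions w|.
(** As [(s_ i * w) x = w (s_ i x)], left multiplication by [s_ i] swaps the values at two
    neighbouring positions. So this is a left descent, the side on which choice maps add letters. *)
Definition descent w i : bool := w (pos1 i) < w (pos0 i).

Lemma pos0_neq_pos1 i : pos0 i != pos1 i.
Proof. by rewrite -val_eqE /=; lia. Qed.

Lemma ascentE w i : (w (pos0 i) < w (pos1 i)) = ~~ descent w i.
Proof.
have ne : val (w (pos0 i)) != val (w (pos1 i)).
  by rewrite val_eqE (inj_eq perm_inj) pos0_neq_pos1.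
by rewrite /descent; move: ne => /=; lia.
Qed.

Lemma s_K i w : (s_ i * (s_ i * w))%g = w.
Proof. by rewrite mulgA tperm2 mul1g. Qed.

Lemma s_inj : injective (@s_ d).
Proof.
move=> i k eik; apply: val_inj.
have : (s_ i (pos0 i) = s_ k (pos0 i)) by rewrite eik.
have : (s_ i (pos1 i) = s_ k (pos1 i)) by rewrite eik.
rewrite /s_ tpermL tpermR; case: tpermP => [/(congr1 val)|/(congr1 val)|_ _] /=.
- by move=> e1 /(congr1 val) /= e2; lia.
- by case.
by move=> /(congr1 val) /=; lia.
Qed.

Lemma descent_s i w : descent (s_ i * w)%g i = ~~ descent w i.
Proof. by rewrite /descent !permM tpermL tpermR -ascentE. Qed.

(** The map [f] preserves the order of every pair of positions except [(pos0 i, pos1 i)]. It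
    therefore matches the inversions of [w] with those of [s_ i * w] other than this pair, which is
    a new inversion. *)
Lemma ninv_ascent w i : ~~ descent w i -> ninv (s_ i * w)%g = (ninv w).+1.
Proof.
move=> asc; pose f (p : 'I_d * 'I_d) := (s_ i p.1, s_ i p.2).
have f_inj : injective f.
  by move=> [a b] [a' b'] [] /perm_inj -> /perm_inj ->.
rewrite /ninv (cardsD1 (pos0 i, pos1 i)) inE /= ltnSn /=.
rewrite -[X in X + _]/(nat_of_bool (descent (s_ i * w)%g i)) descent_s asc add1n.
congr _.+1; rewrite -(card_preimset (inversions w) f_inj); congr #|pred_of_set _|.
apply/setP=> -[a b]; rewrite !inE /= xpair_eqE !permM.
have := asc; rewrite -ascentE => {}asc.
case: (tpermP (pos0 i) (pos1 i) a) => [->|->|/eqP a0 /eqP a1];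
  case: (tpermP (pos0 i) (pos1 i) b) => [->|->|/eqP b0 /eqP b1];
  rewrite ?eqxx -?val_eqE /= ?ltnn //=.
all: move: asc; rewrite -?val_eqE /=; try (move: a0 a1; rewrite -?val_eqE /= => a0 a1).
all: try (move: b0 b1; rewrite -?val_eqE /= => b0 b1).
all: lia.
Qed.

Lemma ninv_descent w i : descent w i -> ninv w = (ninv (s_ i * w)%g).+1.
Proof. by move=> dw; rewrite -(@ninv_ascent _ i) ?s_K // descent_s dw. Qed.

Lemma ninv_sP w i : descent w i = (ninv (s_ i * w)%g < ninv w).
Proof.
case dw: (descent w i); first by rewrite (ninv_descent dw) ltnSn.
by rewrite ninv_ascent ?dw //; lia.
Qed.

Lemma ninv1 : ninv (1%g : 'S_d) = 0.
Proof.
by apply/eqP; rewrite cards_eq0; apply/eqP/setP=> -[a b]; rewrite !inE !perm1 /=; lia.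
Qed.

(* A permutation without descents dominates the identity, and the values of both
   have the same sum. *)
Lemma exists_descent w : w != 1%g -> exists i, descent w i.
Proof.
move=> w1; apply/existsP; apply: contraR w1; rewrite negb_exists => /forallP nodesc.
have ge n (ltnd : n < d) : n <= w (Ordinal ltnd).
  elim: n ltnd => // n IHn ltnd.
  have ltn : n < d.-1 by lia.
  have := ascentE w (Ordinal ltn); rewrite (nodesc (Ordinal ltn)).
  have -> : pos1 (Ordinal ltn) = Ordinal ltnd by apply: val_inj.
  have -> : pos0 (Ordinal ltn) = Ordinal (ltnW ltnd) by apply: val_inj.
  by have := IHn (ltnW ltnd); lia.
have gei (x : 'I_d) : x <= w x ?= iff (x == w x) by case: x => n ?; split; first exact: ge.
have [_] : \sum_(x : 'I_d) x <= \sum_(x : 'I_d) w x ?= iff [forall x, x == w x].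
  exact: leqif_sum.
rewrite (reindex_inj (@perm_inj _ w)) eqxx.
by move=> /esym/forallP e; apply/eqP/permP=> x; rewrite perm1 -(eqP (e x)).
Qed.

Lemma ninv_wprod s : ninv (wprod s) <= size s.
Proof.
elim: s => [|i s IHs] /=; first by rewrite ninv1.
case dw: (descent (wprod s) i); last by rewrite ninv_ascent ?dw.
by have := ninv_descent dw; lia.
Qed.

Lemma exists_word w : exists s, wprod s = w /\ size s = ninv w.
Proof.
move: {2}(ninv w) (erefl (ninv w)) => n; elim: n w => [|n IHn] w winv.
  exists [::]; rewrite winv; split=> //; case: (eqVneq w 1%g) => [//|/exists_descent[i di]].
  by have := ninv_descent di; rewrite winv.
have : w != 1%g by apply/eqP => w1; move: winv; rewrite w1 ninv1.
case/exists_descent=> i di.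
have [|s [ws ss]] := IHn (s_ i * w)%g; first by have := ninv_descent di; lia.
by exists (i :: s); rewrite /= ws s_K ss -(ninv_descent di).
Qed.

Lemma reducedP w s : reduced w s <-> wprod s = w /\ size s = ninv w.
Proof.
split=> -[ws ss]; split=> //.
  apply/eqP; rewrite eqn_leq -{2}ws ninv_wprod andbT.
  by have [s' [ws' <-]] := exists_word w; apply: ss.
by move=> s' ws'; rewrite ss -ws' ninv_wprod.
Qed.

Lemma rwordP w : wprod (rword w) = w /\ size (rword w) = ninv w.
Proof.
apply/reducedP; apply: epsilon_spec.
by have [s /reducedP] := exists_word w; exists s.
Qed.

Lemma descent_far w i k : i.+1 < k \/ k.+1 < i ->
  descent (s_ i * w)%g k = descent w k.
Proof.
by move=> far; rewrite /descent !permM !tpermD // -val_eqE /=; lia.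
Qed.

Lemma s_far i k w : i.+1 < k \/ k.+1 < i ->
  (s_ i * (s_ k * w) = s_ k * (s_ i * w))%g.
Proof.
move=> far; rewrite !mulgA; congr (_ * _)%g.
suff e : (s_ k ^ s_ i = s_ k)%g by rewrite [RHS]conjgC e.
by rewrite tpermJ !tpermD // -val_eqE /=; lia.
Qed.

Definition adjacent i k : Prop := k = i.+1 :> nat \/ i = k.+1 :> nat.

Lemma adjacent_sym i k : adjacent i k -> adjacent k i.
Proof. by rewrite /adjacent; tauto. Qed.

Lemma s_braid i k w : adjacent i k ->
  (s_ i * (s_ k * (s_ i * w)) = s_ k * (s_ i * (s_ k * w)))%g.
Proof.
wlog ik : i k / k = i.+1 :> nat => [hw adj|_].
  by case: (adj) => /hw; [apply | move/(_ (adjacent_sym adj))].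
rewrite !mulgA; congr (_ * _)%g.
have e1 : pos1 i = pos0 k by apply: val_inj.
(* Both conjugates are the transposition of the outer positions [pos0 i] and [pos1 k]. *)
suff e : (s_ k ^ s_ i = s_ i ^ s_ k)%g.
  by move: e; rewrite /conjg !tpermV !mulgA.
have k1 : s_ i (pos1 k) = pos1 k by rewrite tpermD // -val_eqE /=; lia.
have i0 : s_ k (pos0 i) = pos0 i by rewrite tpermD // -val_eqE /=; lia.
by rewrite !tpermJ k1 i0 -e1 tpermR e1 tpermL.
Qed.

(* Two adjacent descents make [w] decreasing on three consecutive positions. *)
Lemma descents_adjacent w i k : adjacent i k -> descent w i -> descent w k ->
  descent (s_ i * w)%g k /\ descent (s_ k * (s_ i * w))%g i.
Proof.
move=> adj; rewrite /descent !permM.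
case: adj => ik.
  have -> : pos0 k = pos1 i by apply: val_inj.
  have k0 : s_ i (pos1 k) = pos1 k by rewrite tpermD // -val_eqE /=; lia.
  have i0 : s_ k (pos0 i) = pos0 i by rewrite tpermD // -val_eqE /=; lia.
  have i1 : s_ k (pos1 i) = pos1 k.
    by rewrite -[X in s_ k X](_ : pos0 k = pos1 i) ?tpermL //; apply: val_inj.
  by rewrite k0 i0 i1 k0 tpermL tpermR; lia.
have -> : pos1 k = pos0 i by apply: val_inj.
have k0 : s_ i (pos0 k) = pos0 k by rewrite tpermD // -val_eqE /=; lia.
have i1 : s_ k (pos1 i) = pos1 i by rewrite tpermD // -val_eqE /=; lia.
have i0 : s_ k (pos0 i) = pos0 k.
  by rewrite -[X in s_ k X](_ : pos1 k = pos0 i) ?tpermR //; apply: val_inj.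
by rewrite k0 i1 i0 k0 tpermL tpermR; lia.
Qed.

(** Stated for functions, so that Matsumoto's theorem applies both to left multiplications in an
    algebra and to operators on a module. *)
Definition braid (X : Type) (f : 'I_d.-1 -> X -> X) : Prop :=
  (forall i k, adjacent i k -> forall x, f i (f k (f i x)) = f k (f i (f k x))) /\
  (forall i k, i.+1 < k -> forall x, f i (f k x) = f k (f i x)).

Lemma trichotomy i k : [\/ i = k, adjacent i k | i.+1 < k \/ k.+1 < i].
Proof.
case: (eqVneq i k) => [->|]; first by constructor 1.
rewrite -val_eqE /= => ne; rewrite /adjacent.
by case: (ltnP i.+1 k) => ?; [constructor 3; left | case: (ltnP k.+1 i) => ?;
  [constructor 3; right | constructor 2; lia]].
Qed.

(* Matsumoto's theorem.  If two reduced words start with different letters [i] and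
   [k], both are descents of [w], so [w] also has a reduced word starting with the
   longest element of the subgroup generated by [s_ i] and [s_ k]. *)
Lemma matsumoto (X : Type) (f : 'I_d.-1 -> X -> X) (x : X) s s' :
  braid f -> wprod s = wprod s' -> size s = ninv (wprod s) -> size s' = ninv (wprod s') ->
  foldr f x s = foldr f x s'.
Proof.
move=> [fbr fcm]; move: {2}(size s) (leqnn (size s)) => n.
elim: n s s' => [|n IHn] [|i u] [|k v] //=.
- by move=> _ <-; rewrite ninv1.
- by move=> _ <-; rewrite ninv1.
- by move=> _ ->; rewrite ninv1.
move=> un; set w := (s_ i * wprod u)%g => ew su sv.
have eu : wprod u = (s_ i * w)%g by rewrite s_K.
have ev : wprod v = (s_ k * w)%g by rewrite ew s_K.
rewrite -ew in sv.
have di : descent w i by rewrite ninv_sP -eu; have := ninv_wprod u; lia.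
have dk : descent w k by rewrite ninv_sP -ev; have := ninv_wprod v; lia.
have iu := ninv_descent di; have iv := ninv_descent dk.
(* By induction, the tail after a descent [a] may be exchanged for any other reduced word of
   [s_ a * w]. *)
have step a s1 (ew1 : wprod s1 = (s_ a * w)%g) t : descent w a -> (size s1).+1 = ninv w ->
    wprod t = (s_ a * w)%g -> size t = size s1 -> foldr f x s1 = foldr f x t.
  move=> da ss1 et st; have ia := ninv_descent da.
  by apply: IHn; rewrite ?ew1 ?et //; lia.
case: (trichotomy i k) => [eik|adj|far].
- by rewrite -eik; congr f; apply: (step i); rewrite // ?eik //; lia.
- have [d1 d2] := descents_adjacent adj di dk.
  have i1 := ninv_descent d1; have i2 := ninv_descent d2.
  have [t [et st]] := exists_word (s_ i * (s_ k * (s_ i * w)))%g.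
  rewrite (step i u eu (k :: i :: t)) /= ?et ?s_K //; last by lia.
  rewrite (step k v ev (i :: k :: t)) /= ?et ?(s_braid _ adj) ?s_K //; last by lia.
  exact: fbr.
have d1 : descent (s_ i * w)%g k by rewrite descent_far.
have i1 := ninv_descent d1.
have [t [et st]] := exists_word (s_ k * (s_ i * w))%g.
rewrite (step i u eu (k :: t)) /= ?et ?s_K //; last by lia.
rewrite (step k v ev (i :: t)) /= ?et ?(s_far _ far) ?s_K //; try lia.
by case: far => lt; [exact: fcm | rewrite (fcm k i)].
Qed.

(** * Short elements and choice maps through prescribed words *)

Lemma descent_s1 i k : descent (s_ i) k = (k == i).
Proof.
case: eqVneq => [->|ne].
  by have := descent_s i 1%g; rewrite mulg1 => ->; rewrite ninv_sP mulg1 ninv1.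
apply: contra_neqF ne => dk; apply: s_inj.
have i1 : ninv (s_ i) <= 1 by have := ninv_wprod [:: i]; rewrite /= mulg1.
(* The length of [s_ i] is at most 1, so a descent [k] leaves length 0, that is, the identity. *)
case: (eqVneq (s_ k * s_ i)%g 1%g) => [e|/exists_descent[l /ninv_descent]].
  by rewrite -(s_K k (s_ i)) e mulg1.
by have := ninv_descent dk; lia.
Qed.

(** Were both [i] and [k] descents, [descents_adjacent] would force length at least 3 on a product
    of two generators. *)
Lemma descent_s2 i k : adjacent i k ->
  descent (s_ k * s_ i)%g k /\ ~~ descent (s_ k * s_ i)%g i.
Proof.
move=> adj; have ik : k != i by rewrite -val_eqE /=; move: adj; rewrite /adjacent; lia.
have dk : descent (s_ k * s_ i)%g k by rewrite descent_s descent_s1.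
split=> //; apply/negP => di.
have [d1 d2] := descents_adjacent adj di dk.
have := ninv_wprod [:: k; i]; rewrite /= mulg1.
by rewrite (ninv_descent di) (ninv_descent d1) (ninv_descent d2).
Qed.

Lemma ninv_s1 i : ninv (s_ i) = 1.
Proof.
have d1 : descent (s_ i) i by rewrite descent_s1 eqxx.
by rewrite (ninv_descent d1) tperm2 ninv1.
Qed.

Lemma ninv_s2 i k : adjacent i k -> ninv (s_ k * s_ i)%g = 2.
Proof. by case/descent_s2=> /ninv_descent -> _; rewrite s_K ninv_s1. Qed.

Lemma ninv_s3 i k : adjacent i k -> ninv (s_ i * (s_ k * s_ i))%g = 3.
Proof. by move=> adj; case: (descent_s2 adj) => _ /ninv_ascent ->; rewrite ninv_s2. Qed.

Lemma exists_choice_map i k : exists r : 'S_d -> seq 'I_d.-1,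
  [/\ choice_map r, (forall w, descent w i -> r w = i :: r (s_ i * w)%g) &
      forall w, ~~ descent w i -> descent w k -> r w = k :: r (s_ k * w)%g].
Proof.
(* Greedy first letter: [i] if possible, else [k], else any descent. The default [i] inside [odflt]
   is reached only at the identity. *)
pose c w := if descent w i then i else if descent w k then k else
  odflt i [pick l | descent w l].
have cP w : w != 1%g -> descent w (c w).
  case/exists_descent=> l dl; rewrite /c; case: ifP => // _; case: ifP => // _.
  by case: pickP => [//|/(_ l)]; rewrite dl.
(* The fuel [ninv w] is exact, since each chosen letter lowers the length by one. *)
pose rw := fix rw n w := if n is n'.+1 then c w :: rw n' (s_ (c w) * w)%g else [::].
pose r w := rw (ninv w) w.
have rS w : w != 1%g -> r w = c w :: r (s_ (c w) * w)%g.
  by move=> /cP/ninv_descent w1; rewrite {1}/r w1.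
have d1 l w : descent w l -> w != 1%g.
  by apply: contraTneq => ->; rewrite ninv_sP ninv1.
exists r; split.
- split=> [|w]; first by rewrite /r ninv1.
  split=> [|/rS ->]; last by exists (c w).
  apply/reducedP; move: {2}(ninv w) (erefl (ninv w)) => n; elim: n w => [|n IHn] w winv.
    suff -> : w = 1%g by rewrite /r ninv1.
    by apply/eqP; apply: contraTT isT => /cP/ninv_descent; rewrite winv.
  have w1 : w != 1%g by apply: contra_eq_neq winv => ->; rewrite ninv1.
  have iw := ninv_descent (cP w w1).
  have [|e1 e2] := IHn (s_ (c w) * w)%g; first lia.
  by rewrite rS //= e1 e2 s_K.
- by move=> w di; rewrite rS ?(d1 i) // /c di.
- by move=> w /negbTE di dk; rewrite rS ?(d1 k) // /c di dk.
Qed.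

Lemma choice_map_s1 i : exists2 r, choice_map r & r (s_ i) = [:: i].
Proof.
have [r [cr ri _]] := exists_choice_map i i; exists r => //.
by rewrite ri ?descent_s1 // tperm2 (proj1 cr).
Qed.

(** Used for [(i, k)] and [(k, i)], this gives two choice maps that pick the two different reduced
    words of the same element. *)
Lemma choice_map_s3 i k : adjacent i k ->
  exists2 r, choice_map r & r (s_ i * (s_ k * s_ i))%g = [:: i; k; i].
Proof.
move=> adj; have [r [cr ri rk]] := exists_choice_map i k; exists r => //.
have [dk di] := descent_s2 adj.
rewrite ri ?descent_s // s_K rk // s_K ri ?descent_s1 // tperm2.
by rewrite (proj1 cr).
Qed.

End Words.

(** * Linear maps out of tensor powers *)
Section Linear.
Variable K : comPzRingType.
Implicit Types U V W : lmodType K.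

Lemma klD U W (g : U -> W) : klinear g -> {morph g : u v / u + v}.
Proof. by move=> lg u v; have := lg 1 u v; rewrite !scale1r. Qed.

Lemma kl0 U W (g : U -> W) : klinear g -> g 0 = 0.
Proof. by move=> lg; apply: (@addIr _ (g 0)); rewrite -klD // !add0r. Qed.

Lemma klZ U W (g : U -> W) : klinear g -> forall a, {morph g : u / a *: u}.
Proof. by move=> lg a u; have := lg a u 0; rewrite (kl0 lg) !addr0. Qed.

Lemma kl_sum U W (g : U -> W) (I : finType) (F : I -> U) : klinear g ->
  g (\sum_i F i) = \sum_i g (F i).
Proof. by move=> lg; apply: (big_morph g (klD lg) (kl0 lg)). Qed.

Lemma kl_id U : klinear (@id U).
Proof. by []. Qed.

Lemma kl_comp U V W (g : V -> W) (f : U -> V) :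
  klinear g -> klinear f -> klinear (fun u => g (f u)).
Proof. by move=> lg lf a u v; rewrite lf lg. Qed.

Variable n : nat.

Section Power.
Variables (V T : lmodType K) (t : ('I_n -> V) -> T).
Hypothesis ht : is_tensor_power t.

Lemma tlift_spec W (f : ('I_n -> V) -> W) : multilinear f ->
  klinear (tlift t f) /\ forall v, tlift t f (t v) = f v.
Proof.
move=> mf; have [g [lg gf _]] := ht.2 W f mf.
by apply: (epsilon_spec _ (fun g => klinear g /\ forall v, g (t v) = f v)); exists g.
Qed.

Lemma tlift_lin W (f : ('I_n -> V) -> W) : multilinear f -> klinear (tlift t f).
Proof. by case/tlift_spec. Qed.

Lemma tliftE W (f : ('I_n -> V) -> W) v : multilinear f -> tlift t f (t v) = f v.
Proof. by case/tlift_spec. Qed.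

Lemma tpow_ext W (g g' : T -> W) : klinear g -> klinear g' ->
  (forall v, g (t v) = g' (t v)) -> g =1 g'.
Proof.
move=> lg lg' e.
have [|g0 [_ _ u]] := ht.2 W (fun v => g' (t v)); first by move=> v k; apply: kl_comp (ht.1 v k).
by move=> x; rewrite (u g) // (u g').
Qed.

(** [tlift] is chosen by [epsilon], so nothing about its dependence on [f] is visible. Uniqueness
    supplies it: both sides are linear in [x] and agree on pure tensors. Commutativity of [K] makes
    the right side linear. *)
Lemma tlift_lin_param U W (f : U -> ('I_n -> V) -> W) :
  (forall u, multilinear (f u)) -> (forall v, klinear (fun u => f u v)) ->
  forall x, klinear (fun u => tlift t (f u) x).
Proof.
move=> mf lf x a u v; move: x.
apply: tpow_ext; first exact: tlift_lin.
  by move=> b x y /=; rewrite !tlift_lin // !scalerDr !scalerA mulrC addrACA.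
by move=> w; rewrite !tliftE // lf.
Qed.

End Power.
End Linear.

(** * Operators on two adjacent tensor factors *)
Section Local.
Variables (K : comPzRingType) (d : nat) (V T T2 : lmodType K).
Variables (t : ('I_d -> V) -> T) (t2 : ('I_2 -> V) -> T2).
Hypotheses (ht : is_tensor_power t) (ht2 : is_tensor_power t2).
Implicit Types (m : 'I_d -> V) (i k : 'I_d.-1) (phi psi : T2 -> T2).

(** Translates a factor of the two-fold tensor power into its position in the [d]-fold one. *)
Definition side i (l : 'I_2) : 'I_d := if l == ord0 then pos0 i else pos1 i.

Lemma pos1_eq0 i : (pos1 i == pos0 i) = false.
Proof. by rewrite eq_sym (negbTE (pos0_neq_pos1 i)). Qed.

Lemma ord2E (l : 'I_2) : l = if l == ord0 then ord0 else ord_max.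
Proof. by case: l => [[|[|//]] ?]; apply: val_inj. Qed.

Lemma upd2_upd_in m i (p : 'I_2 -> V) l x :
  upd2 m i (upd p l x) = upd (upd2 m i p) (side i l) x.
Proof.
apply: functional_extensionality => q; rewrite /upd2 /upd /side [l]ord2E.
case: (l == ord0) => /=; case: (eqVneq q (pos0 i)) => [e|q0] //=.
  by rewrite e [pos0 i == pos1 i]eq_sym pos1_eq0.
by case: eqP.
Qed.

Lemma upd2_upd_side m i (p : 'I_2 -> V) l x : upd2 (upd m (side i l) x) i p = upd2 m i p.
Proof.
apply: functional_extensionality => q; rewrite /upd2 /upd /side.
by case: eqVneq => // q0; case: eqVneq => // q1; case: (l == ord0);
  rewrite ?(negbTE q0) ?(negbTE q1).
Qed.

Lemma pick2_upd_side m i l x : pick2 (upd m (side i l) x) i = upd (pick2 m i) l x.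
Proof.
apply: functional_extensionality => q; rewrite /pick2 /upd /side [l]ord2E [q]ord2E.
by case: (l == ord0); case: (q == ord0); rewrite ?eqxx ?pos1_eq0 //=
  [pos0 i == pos1 i]eq_sym pos1_eq0.
Qed.

Lemma sideP i (q : 'I_d) : (exists l, q = side i l) \/ (q != pos0 i /\ q != pos1 i).
Proof.
case: (eqVneq q (pos0 i)) => [->|q0]; first by left; exists ord0.
case: (eqVneq q (pos1 i)) => [->|q1]; first by left; exists ord_max.
by right.
Qed.

Lemma upd2_upd_out m i (p : 'I_2 -> V) q x : q != pos0 i -> q != pos1 i ->
  upd2 (upd m q x) i p = upd (upd2 m i p) q x.
Proof.
move=> q0 q1; apply: functional_extensionality => r; rewrite /upd2 /upd.
case: (eqVneq r (pos0 i)) => [->|_]; first by rewrite eq_sym (negbTE q0).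
by case: (eqVneq r (pos1 i)) => [->|_] //; rewrite eq_sym (negbTE q1).
Qed.

Lemma pick2_upd_out m i q x : q != pos0 i -> q != pos1 i ->
  pick2 (upd m q x) i = pick2 m i.
Proof.
move=> q0 q1; apply: functional_extensionality => l; rewrite /pick2 /upd.
by rewrite ![_ == q]eq_sym (negbTE q0) (negbTE q1).
Qed.

Lemma multilinear_upd2 m i : multilinear (fun p => t (upd2 m i p)).
Proof. by move=> p l a u v; rewrite !upd2_upd_in; apply: ht.1. Qed.

Lemma tins_lin m i : klinear (tins t t2 m i).
Proof. exact/tlift_lin/multilinear_upd2. Qed.

Lemma tinsE m i p : tins t t2 m i (t2 p) = t (upd2 m i p).
Proof. exact/tliftE/multilinear_upd2. Qed.

Lemma tins_upd_lin m i z q : q != pos0 i -> q != pos1 i ->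
  klinear (fun x => tins t t2 (upd m q x) i z).
Proof.
move=> q0 q1; apply: tlift_lin_param => // [x|p]; first exact: multilinear_upd2.
by move=> a u v; rewrite !upd2_upd_out //; apply: ht.1.
Qed.

Lemma tins_upd_side m i l x : tins t t2 (upd m (side i l) x) i =1 tins t t2 m i.
Proof.
by apply: (tpow_ext ht2) => [||p]; rewrite ?tinsE ?upd2_upd_side //; apply: tins_lin.
Qed.

Section Onf.
Variables phi psi : T2 -> T2.
Hypotheses (lphi : klinear phi) (lpsi : klinear psi).

(** A change at [pos0 i] or [pos1 i] is seen only by [pick2], a change elsewhere only by the
    surrounding vector of [tins]; either dependence is linear. *)
Lemma multilinear_onf i : multilinear (fun m => tins t t2 m i (phi (t2 (pick2 m i)))).
Proof.
move=> m q; case: (sideP i q) => [[l ->]|[q0 q1]] a u v.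
  by rewrite !tins_upd_side !pick2_upd_side (ht2.1 _ _ a) lphi tins_lin.
by rewrite !pick2_upd_out //; apply: tins_upd_lin.
Qed.

Lemma onf_lin i : klinear (onf t t2 phi i).
Proof. exact/tlift_lin/multilinear_onf. Qed.

Lemma onfE i m : onf t t2 phi i (t m) = tins t t2 m i (phi (t2 (pick2 m i))).
Proof. exact/tliftE/multilinear_onf. Qed.

End Onf.

Definition far i k : Prop := (i.+1 < k \/ k.+1 < i)%N.

Lemma far_sym i k : far i k -> far k i.
Proof. by rewrite /far; tauto. Qed.

Lemma far_side i k l : far i k -> side i l != pos0 k /\ side i l != pos1 k.
Proof. by rewrite /far /side; case: (l == ord0); rewrite -!val_eqE /=; lia. Qed.

Lemma pick2_far m i k p : far i k -> pick2 (upd2 m i p) k = pick2 m k.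
Proof.
move=> ik; apply: functional_extensionality => l; rewrite /pick2 /upd2.
by case: (l == ord0); rewrite -!val_eqE /=; do 2?[case: eqP => [?|_]]; move: ik;
  rewrite /far //; lia.
Qed.

Lemma upd2_far m i k p q : far i k ->
  upd2 (upd2 m i p) k q = upd2 (upd2 m k q) i p.
Proof.
move=> ik; apply: functional_extensionality => l; rewrite /upd2 -!val_eqE /=.
by do 4?[case: eqP => [?|_] //]; move: ik; rewrite /far; lia.
Qed.

Lemma multilinear_tins_far m i k z : far i k ->
  multilinear (fun p => tins t t2 (upd2 m i p) k z).
Proof.
move=> ik p l a u v; rewrite !upd2_upd_in.
by have [??] := far_side l ik; apply: tins_upd_lin.
Qed.

(** Insertions at disjoint places: both sides are linear in [x] and in [z], which reduces to pure
    tensors, where updates commute. *)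
Lemma tins_far m i k x z : far i k ->
  tlift t2 (fun p => tins t t2 (upd2 m i p) k z) x =
  tlift t2 (fun q => tins t t2 (upd2 m k q) i x) z.
Proof.
move=> ik; have ki := far_sym ik.
move: z; apply: (tpow_ext ht2).
- apply: tlift_lin_param => // [z|p]; first exact: multilinear_tins_far.
  exact: tins_lin.
- exact/tlift_lin/multilinear_tins_far.
move=> q; rewrite [RHS]tliftE //; last exact: multilinear_tins_far.
move: x; apply: (tpow_ext ht2); [exact/tlift_lin/multilinear_tins_far|exact: tins_lin|].
by move=> p; rewrite (tliftE ht2 _ (multilinear_tins_far m _ ik)) !tinsE upd2_far.
Qed.

Lemma onf_tins_far phi m i k x : klinear phi -> far i k ->
  onf t t2 phi k (tins t t2 m i x) =
  tlift t2 (fun p => tins t t2 (upd2 m i p) k (phi (t2 (pick2 m k)))) x.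
Proof.
move=> lphi ik; move: x; apply: (tpow_ext ht2).
- by apply: kl_comp; [apply: onf_lin | apply: tins_lin].
- exact/tlift_lin/multilinear_tins_far.
move=> p; rewrite tliftE //; last exact: multilinear_tins_far.
by rewrite tinsE onfE // pick2_far.
Qed.

(** On a pure tensor both composites insert the same two values at disjoint places. This is why no
    condition on distant indices appears among (M2)-(M7). *)
Lemma onf_far phi psi i k x : klinear phi -> klinear psi -> far i k ->
  onf t t2 phi i (onf t t2 psi k x) = onf t t2 psi k (onf t t2 phi i x).
Proof.
move=> lphi lpsi ik; have ki := far_sym ik; move: x; apply: (tpow_ext ht).
- by apply: kl_comp; apply: onf_lin.
- by apply: kl_comp; apply: onf_lin.
by move=> m; rewrite !onfE // !onf_tins_far // tins_far.
Qed.

End Local.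

(** * The action of a tensor power of an algebra *)
Section Action.
Variables (K : comPzRingType) (B : algType K) (M : lmodType K) (actM : B -> M -> M).
Hypothesis hM : left_module actM.

(** A scalar acts as the central element [k%:A] of [B], hence commutes with the action of [a]. *)
Lemma actM_linr a : klinear (actM a).
Proof.
case: hM => act1 actA actDl actDr actZ k u v.
by rewrite actDr -!actZ -!actA mulr_algl mulr_algr.
Qed.

Lemma actM_linl m : klinear (actM^~ m).
Proof. by case: hM => act1 actA actDl actDr actZ k u v; rewrite actDl -mulr_algl actA actZ. Qed.

Variables (n : nat) (TB TM : lmodType K) (tB : ('I_n -> B) -> TB) (tM : ('I_n -> M) -> TM).
Hypotheses (hTB : is_tensor_power tB) (hTM : is_tensor_power tM).
Local Notation act := (tact tB tM actM).

Lemma multilinear_factorwise (U : lmodType K) (V W : lmodType K) (t : ('I_n -> W) -> U)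
    (f : 'I_n -> V -> W) :
  multilinear t -> (forall k, klinear (f k)) -> multilinear (fun v => t (fun k => f k (v k))).
Proof.
move=> mt lf v k a x y.
have e z : (fun l => f l (upd v k z l)) = upd (fun l => f l (v l)) k (f k z).
  by apply: functional_extensionality => l; rewrite /upd; case: eqP => // ->.
by rewrite !e lf; apply: mt.
Qed.

Lemma multilinear_act_pure a : multilinear (fun v => tM (fun k => actM (a k) (v k))).
Proof. exact: (multilinear_factorwise (f := fun k => actM (a k)) hTM.1 (fun k => @actM_linr (a k))). Qed.

Lemma multilinear_act m :
  multilinear (fun a => tlift tM (fun v => tM (fun k => actM (a k) (v k))) m).
Proof.
move=> a k; apply: tlift_lin_param => // [x|v]; first exact: multilinear_act_pure.
exact: (multilinear_factorwise (f := fun k b => actM b (v k)) hTM.1 (fun k => @actM_linl (v k))).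
Qed.

Lemma act_linl m : klinear (act^~ m).
Proof. exact/tlift_lin/multilinear_act. Qed.

Lemma act_linr b : klinear (act b).
Proof.
apply: tlift_lin_param => // [m|a]; first exact: multilinear_act.
exact/tlift_lin/multilinear_act_pure.
Qed.

Lemma actE a v : act (tB a) (tM v) = tM (fun k => actM (a k) (v k)).
Proof.
by rewrite /tact tliftE; [rewrite tliftE //; apply: multilinear_act_pure| |apply: multilinear_act].
Qed.

Lemma tact1 m : act (tB (fun _ => 1)) m = m.
Proof.
move: m; apply: (tpow_ext hTM) => [||v]; [exact: act_linr | exact: kl_id |].
by rewrite actE; congr tM; apply: functional_extensionality => k; case: hM.
Qed.

(* [TB] carries no multiplication of its own; [j] provides it. *)
Lemma actM_mul (A : algType K) (j : TB -> A) : klinear j ->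
  (forall b c, j (tB b) * j (tB c) = j (tB (fun k => b k * c k))) ->
  forall b c, exists2 e, j e = j b * j c & forall m, act e m = act b (act c m).
Proof.
move=> lj jM b c.
pose mulp (a c : 'I_n -> B) := tB (fun k => a k * c k).
have mulr a : multilinear (mulp a).
  apply: (multilinear_factorwise (f := fun k b => a k * b) hTB.1) => k x u v.
  by rewrite mulrDr scalerAr.
have mull c0 : multilinear (mulp^~ c0).
  apply: (multilinear_factorwise (f := fun k b => b * c0 k) hTB.1) => k x u v.
  by rewrite mulrDl scalerAl.
have mult c0 : multilinear (fun a => tlift tB (mulp a) c0).
  by move=> a k; apply: tlift_lin_param => // v; apply: mull.
have linl c0 : klinear (fun b => tlift tB (fun a => tlift tB (mulp a) c0) b).
  exact: tlift_lin.
have linr b0 : klinear (fun c => tlift tB (fun a => tlift tB (mulp a) c) b0).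
  by apply: tlift_lin_param => // a; apply: tlift_lin.
have mulE a0 c0 : tlift tB (fun a => tlift tB (mulp a) (tB c0)) (tB a0) = mulp a0 c0.
  by rewrite tliftE // tliftE.
(* The witness is the factorwise product of [b] and [c], the bilinear extension of [mulp]. *)
exists (tlift tB (fun a => tlift tB (mulp a) c) b) => [|m].
  move: b; apply: (tpow_ext hTB); first exact: kl_comp.
    by move=> a u v; rewrite lj mulrDl scalerAl.
  move=> b; move: c; apply: (tpow_ext hTB); first exact: kl_comp.
    by move=> a u v; rewrite lj mulrDr scalerAr.
  by move=> c; rewrite mulE jM.
move: b; apply: (tpow_ext hTB); first exact: (kl_comp (@act_linl m)).
  exact: act_linl.
move=> b; move: c; apply: (tpow_ext hTB); first exact: (kl_comp (@act_linl m)).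
  exact: (kl_comp (@act_linr _) (@act_linl m)).
move=> c; move: m; apply: (tpow_ext hTM); first exact: act_linr.
  exact: (kl_comp (@act_linr _) (@act_linr _)).
move=> v; rewrite mulE !actE; congr tM; apply: functional_extensionality => k.
by case: hM.
Qed.

End Action.

(** * Normal forms in Hecke-type algebras *)
Section NormalForms.
Variables (K : comPzRingType) (d : nat).

(** * Products along reduced words *)

Section Gword.
Variables (R : algType K) (g : 'I_d.-1 -> R).
Hypothesis gbraid : forall i k : 'I_d.-1, val k = i.+1 -> g i * g k * g i = g k * g i * g k.
Hypothesis gcomm : forall i k : 'I_d.-1, (i.+1 < k)%N -> g i * g k = g k * g i.

Lemma braid_mul : braid (fun i a => g i * a).
Proof.
split=> i k ik a; last by rewrite !mulrA gcomm.
by rewrite !mulrA; case: ik => /gbraid; rewrite ?mulrA => ->.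
Qed.

(** [gword] uses the arbitrary reduced word [rword]; Matsumoto's theorem lets any other reduced word
    replace it. *)
Lemma gword_reduced s : size s = ninv (wprod s) ->
  gword g (wprod s) = foldr (fun i a => g i * a) 1 s.
Proof.
move=> ss; have [e1 e2] := rwordP (wprod s).
by apply: matsumoto; [exact: braid_mul | rewrite e1 | rewrite e1 |].
Qed.

Lemma gword1 : gword g 1%g = 1.
Proof. by rewrite (gword_reduced (s := [::])) //= ninv1. Qed.

Lemma gword_s i : gword g (s_ i) = g i.
Proof.
have := gword_reduced (s := [:: i]); rewrite /= mulg1 mulr1; apply.
by rewrite ninv_s1.
Qed.

Lemma gword_ascent i w : ~~ descent w i -> gword g (s_ i * w)%g = g i * gword g w.
Proof.
move=> asc; have [e1 e2] := rwordP w.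
have := gword_reduced (s := i :: rword w); rewrite /= e1; apply.
by rewrite ninv_ascent // e2.
Qed.

End Gword.

(** * A representation built on the PBW basis *)

Section Representation.
Variables (TB : lmodType K) (A : algType K) (j : TB -> A) (H : 'I_d.-1 -> A).
Hypothesis lj : klinear j.
Hypothesis hpbw : bijective (fun f : {ffun 'S_d -> TB} => \sum_w j (f w) * gword H w).

Lemma pbw_sum a : \sum_w j (pbw_coord j H a w) * gword H w = a.
Proof.
have [g _ gK] := hpbw.
pose P f := \sum_w j (f w) * gword H w = a.
by apply: (epsilon_spec _ (P : {ffun 'S_d -> TB} -> Prop)); exists (g a); apply: gK.
Qed.

Lemma pbw_uniq (f : {ffun 'S_d -> TB}) a :
  \sum_w j (f w) * gword H w = a -> pbw_coord j H a = f.
Proof. by move=> fa; apply: (bij_inj hpbw); rewrite /= pbw_sum. Qed.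

Lemma pbw_lin w : klinear (fun a => pbw_coord j H a w).
Proof.
move=> c a b; pose f := [ffun w => c *: pbw_coord j H a w + pbw_coord j H b w].
rewrite (@pbw_uniq f) ?ffunE // -[in RHS](pbw_sum a) -[in RHS](pbw_sum b).
rewrite scaler_sumr -big_split; apply: eq_bigr => v _.
by rewrite ffunE lj mulrDl scalerAl.
Qed.

Lemma pbw_mono b w : pbw_coord j H (j b * gword H w) = [ffun v => if v == w then b else 0].
Proof.
apply: pbw_uniq; rewrite (bigD1 w) //= ffunE eqxx big1 ?addr0 // => v /negbTE vw.
by rewrite ffunE vw (kl0 lj) mul0r.
Qed.

Variables (N : lmodType K) (bact : TB -> N -> N).
Hypothesis bactl : forall F, klinear (bact^~ F).
Hypothesis bactr : forall b, klinear (bact b).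

(** Replaces each [H_g] in the normal form of [a] by the vector [E g]. With [E g] equal to
    [tau r g m] this is the left-hand shape of the ground module identities ([sum_act_tau]); with
    [E g] equal to [T_g F] it is [rep]. *)
Definition eval_pbw (E : 'S_d -> N) (a : A) : N := \sum_g bact (pbw_coord j H a g) (E g).

Lemma eval_pbw_lin E : klinear (eval_pbw E).
Proof.
move=> c a b; rewrite scaler_sumr -big_split; apply: eq_bigr => g _.
by rewrite pbw_lin bactl.
Qed.

Lemma eval_pbw_mono E b w : eval_pbw E (j b * gword H w) = bact b (E w).
Proof.
rewrite /eval_pbw pbw_mono (bigD1 w) //= ffunE eqxx big1 ?addr0 // => v /negbTE vw.
by rewrite ffunE vw (kl0 (bactl _)).
Qed.

Variables (one : TB) (sig rh : 'I_d.-1 -> TB -> TB) (S_ R_ : 'I_d.-1 -> TB).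
Hypothesis j1 : j one = 1.
Hypothesis bact1 : forall F, bact one F = F.
Hypothesis Hbraid : forall i k : 'I_d.-1, val k = i.+1 -> H i * H k * H i = H k * H i * H k.
Hypothesis Hcomm : forall i k : 'I_d.-1, (i.+1 < k)%N -> H i * H k = H k * H i.

Lemma eval_pbw_gword E w : eval_pbw E (gword H w) = E w.
Proof. by rewrite -[gword H w]mul1r -j1 eval_pbw_mono bact1. Qed.

Hypothesis bactM : forall b c,
  exists2 e, j e = j b * j c & forall F, bact e F = bact b (bact c F).
Hypothesis Hsq : forall i, H i * H i = j (S_ i) * H i + j (R_ i).
Hypothesis Hj : forall i b, H i * j b = j (sig i b) * H i + j (rh i b).

Variable T : 'I_d.-1 -> N -> N.
Hypothesis Tlin : forall i, klinear (T i).
Hypothesis Tbraid : braid T.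
Hypothesis Tsq : forall i F, T i (T i F) = bact (S_ i) (T i F) + bact (R_ i) F.
Hypothesis Tb : forall i b F, T i (bact b F) = bact (sig i b) (T i F) + bact (rh i b) F.

Definition rep (a : A) (F : N) : N := eval_pbw (fun g => foldr T F (rword g)) a.

Lemma foldr_rword s F : size s = ninv (wprod s) ->
  foldr T F (rword (wprod s)) = foldr T F s.
Proof. by move=> ss; have [e1 e2] := rwordP (wprod s); apply: matsumoto; rewrite ?e1. Qed.

Lemma foldr_rword_ascent i w F : ~~ descent w i ->
  foldr T F (rword (s_ i * w)%g) = T i (foldr T F (rword w)).
Proof.
move=> asc; have [e1 e2] := rwordP w.
have := @foldr_rword (i :: rword w) F; rewrite /= e1; apply.
by rewrite ninv_ascent // e2.
Qed.

Lemma rep_j b a F : rep (j b * a) F = bact b (rep a F).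
Proof.
rewrite -{1}(pbw_sum a) mulr_sumr /rep (kl_sum _ (@eval_pbw_lin _)) (kl_sum _ (@bactr b)).
apply: eq_bigr => w _; rewrite mulrA; have [e <- eE] := bactM b (pbw_coord j H a w).
by rewrite eval_pbw_mono eE.
Qed.

(** At an ascent, [H_i H_w] is again a basis element. At a descent, [H_w = H_i H_v] with [v]
    shorter, and the quadratic relation for [H_i] is matched by [Tsq]. *)
Lemma rep_H_gword i w F : rep (H i * gword H w) F = T i (rep (gword H w) F).
Proof.
rewrite {2}/rep eval_pbw_gword.
case dw: (descent w i); last first.
  by rewrite -gword_ascent ?dw // /rep eval_pbw_gword foldr_rword_ascent ?dw.
set v := (s_ i * w)%g.
have av : ~~ descent v i by rewrite descent_s dw.
have -> : w = (s_ i * v)%g by rewrite s_K.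
rewrite gword_ascent // foldr_rword_ascent // mulrA Hsq mulrDl -mulrA Tsq.
rewrite /rep (klD (@eval_pbw_lin _)) -!/(rep _ _) !rep_j -gword_ascent //.
by rewrite /rep !eval_pbw_gword foldr_rword_ascent.
Qed.

(** In the PBW expansion of [a], the relation [Hj] moves [H_i] past each coefficient, exactly as
    [Tb] moves [T_i]; then [rep_H_gword] applies. *)
Lemma rep_H i a F : rep (H i * a) F = T i (rep a F).
Proof.
rewrite -{1}(pbw_sum a) mulr_sumr {2}/rep (kl_sum _ (@Tlin i)).
rewrite {1}/rep (kl_sum _ (@eval_pbw_lin _)); apply: eq_bigr => w _.
rewrite mulrA Hj mulrDl -mulrA (klD (@eval_pbw_lin _)) -!/(rep _ F) !rep_j rep_H_gword.
by rewrite /rep !eval_pbw_gword Tb.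
Qed.

Lemma rep1 F : rep 1 F = F.
Proof.
rewrite -(gword1 Hbraid Hcomm) /rep eval_pbw_gword.
by have [_] := rwordP (1%g : 'S_d); rewrite ninv1; case: (rword _).
Qed.

Lemma rep_gword w a F : rep (gword H w * a) F = foldr T (rep a F) (rword w).
Proof.
rewrite /gword; elim: (rword w) => [|i s IHs] /=; first by rewrite mul1r.
by rewrite -mulrA rep_H IHs.
Qed.

End Representation.
End NormalForms.

(** * The operators [Tstep] on the tensor product of a module with the Hecke algebra *)
Section Tau.
Variables (K : comPzRingType) (d : nat) (chiS chiR : K) (Ht : algType K) (h : 'I_d.-1 -> Ht).
Hypothesis hHt : twisted_hecke chiS chiR h.

Lemma coordH_sum x : \sum_w coordH h x w *: gword h w = x.
Proof.
have [_ _ _ [g _ gK]] := hHt; pose P c := \sum_w c w *: gword h w = x.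
by apply: (epsilon_spec _ (P : {ffun 'S_d -> K} -> Prop)); exists (g x); apply: gK.
Qed.

Lemma coordH_uniq (c : {ffun 'S_d -> K}) x : \sum_w c w *: gword h w = x -> coordH h x = c.
Proof. by case: hHt => _ _ _ bij cx; apply: (bij_inj bij); rewrite /= coordH_sum. Qed.

Lemma coordH_lin a x y w : coordH h (a *: x + y) w = a * coordH h x w + coordH h y w.
Proof.
pose c := [ffun w => a * coordH h x w + coordH h y w].
rewrite (@coordH_uniq c) ?ffunE // -[in RHS](coordH_sum x) -[in RHS](coordH_sum y).
rewrite scaler_sumr -big_split; apply: eq_bigr => v _.
by rewrite ffunE scalerDl scalerA.
Qed.

Lemma coordH_gword v w : coordH h (gword h v) w = (w == v)%:R.
Proof.
rewrite (@coordH_uniq [ffun w => (w == v)%:R]) ?ffunE // (bigD1 v) //= ffunE eqxx scale1r.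
by rewrite big1 ?addr0 // => u /negbTE uv; rewrite ffunE uv scale0r.
Qed.

Variables (TM : lmodType K) (sM rM : 'I_d.-1 -> TM -> TM).
Hypotheses (lsM : forall i, klinear (sM i)) (lrM : forall i, klinear (rM i)).
Local Notation N := {ffun 'S_d -> TM}.
Local Notation T := (Tstep h sM rM).

(** The pure tensor of [m] and [x], in coordinates along the basis of [Ht]. By [ten_ext] identities
    of linear operators need only be checked on these. *)
Definition ten (m : TM) (x : Ht) : N := [ffun g => coordH h x g *: m].

Lemma ten_linl x : klinear (ten^~ x).
Proof. by move=> a m m'; apply/ffunP => g; rewrite !ffunE scalerDr !scalerA mulrC. Qed.

Lemma ten_linr m : klinear (ten m).
Proof. by move=> a x y; apply/ffunP => g; rewrite !ffunE coordH_lin scalerDl scalerA. Qed.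

Lemma ten_sum (F : N) : F = \sum_v ten (F v) (gword h v).
Proof.
apply/ffunP => g; rewrite sum_ffunE (bigD1 g) //= ffunE coordH_gword eqxx scale1r.
by rewrite big1 ?addr0 // => v vg; rewrite ffunE coordH_gword eq_sym (negbTE vg) scale0r.
Qed.

Lemma ten_ext (W : lmodType K) (f f' : N -> W) : klinear f -> klinear f' ->
  (forall m x, f (ten m x) = f' (ten m x)) -> f =1 f'.
Proof.
move=> lf lf' e F; rewrite (ten_sum F) (kl_sum _ lf) (kl_sum _ lf').
by apply: eq_bigr => v _; apply: e.
Qed.

Lemma Tstep_lin i : klinear (T i).
Proof.
move=> a F G; apply/ffunP => g; rewrite !ffunE lrM scalerDr addrACA; congr (_ + _).
rewrite scaler_sumr -big_split; apply: eq_bigr => v _.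
by rewrite !ffunE lsM scalerDr !scalerA mulrC.
Qed.

Lemma Tstep_ten i m x : T i (ten m x) = ten (sM i m) (h i * x) + ten (rM i m) x.
Proof.
apply/ffunP => g; rewrite !ffunE (klZ (@lrM i)); congr (_ + _).
(* The regular module [K^o] lets a scalar coordinate count as a [klinear] map. *)
have lc : klinear (fun y => coordH h y g : K^o) by move=> a u v; rewrite coordH_lin.
rewrite -{2}(coordH_sum x) mulr_sumr (kl_sum _ lc) scaler_suml; apply: eq_bigr => v _.
by rewrite ffunE (klZ (@lsM i)) -scalerAr (klZ lc) scalerA mulrC.
Qed.

Lemma rmulH_lin y : klinear (fun F : N => rmulH h F y).
Proof.
move=> a F G; apply/ffunP => g; rewrite !ffunE scaler_sumr -big_split.
by apply: eq_bigr => v _; rewrite !ffunE scalerDr !scalerA mulrC.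
Qed.

Lemma rmulH_ten m x y : rmulH h (ten m x) y = ten m (x * y).
Proof.
apply/ffunP => g; rewrite !ffunE.
have lc : klinear (fun y => coordH h y g : K^o) by move=> a u v; rewrite coordH_lin.
rewrite -{2}(coordH_sum x) mulr_suml (kl_sum _ lc) scaler_suml; apply: eq_bigr => v _.
by rewrite ffunE -scalerAl (klZ lc) scalerA mulrC.
Qed.

Lemma foldr_Tstep_lin s : klinear (foldr T ^~ s).
Proof. by elim: s => [|i s IHs] //=; apply: kl_comp IHs; apply: Tstep_lin. Qed.

(** [Tstep] multiplies by [h i] on the left, so this is associativity in [Ht]. *)
Lemma rmulH_Tstep i F y : rmulH h (T i F) y = T i (rmulH h F y).
Proof.
move: F; apply: ten_ext => [||m x].
- by apply: (kl_comp (@rmulH_lin y)); apply: Tstep_lin.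
- by apply: kl_comp (@rmulH_lin y); apply: Tstep_lin.
by rewrite rmulH_ten !Tstep_ten (klD (@rmulH_lin y)) !rmulH_ten mulrA.
Qed.

Lemma rmulH_foldr s F y : rmulH h (foldr T F s) y = foldr T (rmulH h F y) s.
Proof. by elim: s => [|i s IHs] //=; rewrite rmulH_Tstep IHs. Qed.

Let hbraid : forall i k : 'I_d.-1, val k = i.+1 -> h i * h k * h i = h k * h i * h k.
Proof. by case: hHt. Qed.
Let hcomm : forall i k : 'I_d.-1, (i.+1 < k)%N -> h i * h k = h k * h i.
Proof. by case: hHt. Qed.
Let hsq : forall i, h i * h i = chiS *: h i + chiR%:A.
Proof. by case: hHt. Qed.

Lemma ten1 m : [ffun g => if g == 1%g then m else 0] = ten m 1.
Proof.
apply/ffunP => g; rewrite !ffunE -(gword1 hbraid hcomm) coordH_gword.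
by case: eqP; rewrite ?scale1r ?scale0r.
Qed.

Lemma tauE r w m : tau h sM rM r w m = foldr T (ten m 1) (r w).
Proof. by rewrite /tau ten1. Qed.

(** Each [F] is the sum of the elements [ten (F v) 1] multiplied on the right by [h_v], and the
    operators commute with right multiplication. For [F] equal to [tau r x m] this evaluates the
    right side of the second ground module identity. *)
Lemma sum_rmulH_tau r w (F : N) :
  [ffun y => \sum_v rmulH h (tau h sM rM r w (F v)) (gword h v) y] = foldr T F (r w).
Proof.
rewrite [in RHS](ten_sum F) (kl_sum _ (@foldr_Tstep_lin _)).
apply/ffunP => y; rewrite ffunE sum_ffunE; apply: eq_bigr => v _.
by rewrite tauE rmulH_foldr rmulH_ten mul1r.
Qed.

Lemma hsq_mul i x : h i * (h i * x) = chiS *: (h i * x) + chiR *: x.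
Proof. by rewrite mulrA hsq mulrDl -!scalerAl mul1r. Qed.

Lemma Tstep2_ten i m x : T i (T i (ten m x)) =
  ten (chiS *: sM i (sM i m) + rM i (sM i m) + sM i (rM i m)) (h i * x)
  + ten (chiR *: sM i (sM i m) + rM i (rM i m)) x.
Proof.
rewrite !(Tstep_ten, klD (@Tstep_lin _)) hsq_mul (klD (@ten_linr _)) !(klZ (@ten_linr _)).
rewrite !(klD (@ten_linl _)) !(klZ (@ten_linl _)) !addrA.
by rewrite (ACl (1*3*4*2*5)).
Qed.

Lemma Tstep3_ten i k m x : T i (T k (T i (ten m x))) =
  ten (sM i (sM k (sM i m))) (h i * (h k * (h i * x)))
  + ten (sM i (sM k (rM i m))) (h i * (h k * x))
  + ten (rM i (sM k (sM i m))) (h k * (h i * x))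
  + ten (chiS *: sM i (rM k (sM i m)) + rM i (rM k (sM i m)) + sM i (rM k (rM i m))) (h i * x)
  + ten (rM i (sM k (rM i m))) (h k * x)
  + ten (rM i (rM k (rM i m)) + chiR *: sM i (rM k (sM i m))) x.
Proof.
rewrite !(Tstep_ten, klD (@Tstep_lin _)) hsq_mul (klD (@ten_linr _)) !(klZ (@ten_linr _)).
rewrite !(klD (@ten_linl _)) !(klZ (@ten_linl _)) !addrA.
(* There are nine terms: one for each of the eight choices of [sM] or [rM], and one more because the
   quadratic relation splits [h i * (h i * x)]. *)
by rewrite (ACl (1*6*2*3*5*8*7*9*4)).
Qed.

Definition braid_conditions i k m : Prop :=
  [/\ sM i (sM k (sM i m)) = sM k (sM i (sM k m)),
      rM i (sM k (sM i m)) = sM k (sM i (rM k m)),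
      rM i (sM k (rM i m)) =
        chiS *: sM k (rM i (sM k m)) + rM k (rM i (sM k m)) + sM k (rM i (rM k m)) &
      rM i (rM k (rM i m)) + chiR *: sM i (rM k (sM i m)) =
        rM k (rM i (rM k m)) + chiR *: sM k (rM i (sM k m))].

Lemma hecke_braid i k x : adjacent i k ->
  h i * (h k * (h i * x)) = h k * (h i * (h k * x)).
Proof. by move=> adj; apply: (proj1 (braid_mul hbraid hcomm)). Qed.

Lemma ten_word m s w : size s = ninv (wprod s) ->
  ten m (foldr (fun i a => h i * a) 1 s) w = if w == wprod s then m else 0.
Proof.
move=> ss; rewrite ffunE -(gword_reduced hbraid hcomm ss) coordH_gword.
by case: eqP; rewrite ?scale1r ?scale0r.
Qed.

Lemma parabolic_uniq (i k : 'I_d.-1) : adjacent i k ->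
  uniq [:: s_ i * (s_ k * s_ i); s_ i * s_ k; s_ k * s_ i; s_ i; s_ k; 1]%g.
Proof.
move=> adj; have adj' := adjacent_sym adj.
have neq (u v : 'S_d) : ninv u != ninv v -> u != v by apply: contra_neq => ->.
rewrite /= !inE !negb_or; do ![apply/andP; split]=> //.
all: try by apply: neq; rewrite ?(ninv_s3 adj) ?(ninv_s2 adj) ?(ninv_s2 adj') ?ninv_s1 ?ninv1.
all: try by rewrite (inj_eq (@s_inj d)) -val_eqE; case: adj => /=; lia.
(* Lengths do not separate [s_ i * s_ k] from [s_ k * s_ i], but [i] is a descent of the first
   only. *)
apply: contraTneq (proj1 (descent_s2 adj')) => ->.
exact: proj2 (descent_s2 adj).
Qed.

(** The six words are reduced and represent distinct permutations, so evaluating at these isolates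
    the coefficients. The trailing factors 1 match [Tstep3_ten] at [x = 1]. *)
Lemma ten_parabolic_inj i k a1 a2 a3 a4 a5 a6 b1 b2 b3 b4 b5 b6 : adjacent i k ->
  ten a1 (h i * (h k * (h i * 1))) + ten a2 (h i * (h k * 1)) + ten a3 (h k * (h i * 1))
    + ten a4 (h i * 1) + ten a5 (h k * 1) + ten a6 1 =
  ten b1 (h i * (h k * (h i * 1))) + ten b2 (h i * (h k * 1)) + ten b3 (h k * (h i * 1))
    + ten b4 (h i * 1) + ten b5 (h k * 1) + ten b6 1 ->
  [/\ a1 = b1, a2 = b2, a3 = b3 & [/\ a4 = b4, a5 = b5 & a6 = b6]].
Proof.
move=> adj; have adj' := adjacent_sym adj.
have := parabolic_uniq adj; set L := [:: _; _; _; _; _; _] => uL.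
have nL p q : (p < 6)%N -> (q < 6)%N -> (nth 1%g L p == nth 1%g L q) = (p == q).
  by move=> ltp ltq; apply: nth_uniq.
have t1 m g : ten m (h i * (h k * (h i * 1))) g = if g == nth 1%g L 0 then m else 0.
  by have := @ten_word m [:: i; k; i] g; rewrite /= mulg1 ninv_s3 // => ->.
have t2 m g : ten m (h i * (h k * 1)) g = if g == nth 1%g L 1 then m else 0.
  by have := @ten_word m [:: i; k] g; rewrite /= mulg1 ninv_s2 // => ->.
have t3 m g : ten m (h k * (h i * 1)) g = if g == nth 1%g L 2 then m else 0.
  by have := @ten_word m [:: k; i] g; rewrite /= mulg1 ninv_s2 // => ->.
have t4 m g : ten m (h i * 1) g = if g == nth 1%g L 3 then m else 0.
  by have := @ten_word m [:: i] g; rewrite /= mulg1 ninv_s1 // => ->.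
have t5 m g : ten m (h k * 1) g = if g == nth 1%g L 4 then m else 0.
  by have := @ten_word m [:: k] g; rewrite /= mulg1 ninv_s1 // => ->.
have t6 m g : ten m 1 g = if g == nth 1%g L 5 then m else 0.
  by have := @ten_word m [::] g; rewrite /= ninv1 // => ->.
have addE (F G : N) g : (F + G) g = F g + G g by rewrite ffunE.
move=> /ffunP e; split; last split.
all: [> move: (e (nth 1%g L 0)) | move: (e (nth 1%g L 1)) | move: (e (nth 1%g L 2))
      | move: (e (nth 1%g L 3)) | move: (e (nth 1%g L 4)) | move: (e (nth 1%g L 5))].
all: by rewrite !addE !t1 !t2 !t3 !t4 !t5 !t6 !nL //= ?addr0 ?add0r.
Qed.

(** The coefficients of [h_k h_i x] and [h_k x] agree by the conditions for [(i, k)], those of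
    [h_i h_k x] and [h_i x] by the conditions for [(k, i)]. *)
Lemma Tstep3_eq i k m : adjacent i k -> braid_conditions i k m -> braid_conditions k i m ->
  forall x, T i (T k (T i (ten m x))) = T k (T i (T k (ten m x))).
Proof.
move=> adj [ss rs r6 r7] [_ rs' r6' _] x; rewrite !Tstep3_ten hecke_braid //.
rewrite ss rs rs' r6 r6' r7 -!addrA; congr (_ + _).
by rewrite addrCA; congr (_ + (_ + _)); rewrite addrCA.
Qed.

Lemma Tstep3_inj i k m : adjacent i k ->
  T i (T k (T i (ten m 1))) = T k (T i (T k (ten m 1))) -> braid_conditions i k m.
Proof.
(* The right side is expanded for [(k, i)]; the permutation lists its Hecke words in the order of
   the left side. *)
move=> adj; rewrite !Tstep3_ten -(hecke_braid _ adj) [RHS](ACl (1*3*2*5*4*6)) /=.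
by case/(ten_parabolic_inj adj)=> e1 e2 e3 [e4 e5 e6].
Qed.

Lemma Tstep_braid :
  (forall i k : 'I_d.-1, (i.+1 < k)%N -> forall m,
    [/\ sM i (sM k m) = sM k (sM i m), sM i (rM k m) = rM k (sM i m),
        rM i (sM k m) = sM k (rM i m) & rM i (rM k m) = rM k (rM i m)]) ->
  (forall i k, adjacent i k -> forall m, braid_conditions i k m) -> braid T.
Proof.
move=> comm cond; split=> i k ik; apply: ten_ext; try by do !apply: kl_comp; apply: Tstep_lin.
  move=> m x; apply: Tstep3_eq => //; apply: cond => //; exact: adjacent_sym.
move=> m x; rewrite !(Tstep_ten, klD (@Tstep_lin _)) /=.
have [-> -> -> ->] := comm i k ik m.
by rewrite (proj2 (braid_mul hbraid hcomm)) // !addrA (ACl (1*3*2*4)).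
Qed.

Variables (TB : lmodType K) (act : TB -> TM -> TM).
Hypotheses (actl : forall m, klinear (act^~ m)) (actr : forall b, klinear (act b)).

Definition actN (b : TB) (F : N) : N := [ffun g => act b (F g)].

Lemma actN_linl F : klinear (actN^~ F).
Proof. by move=> a b c; apply/ffunP => g; rewrite !ffunE actl. Qed.

Lemma actN_linr b : klinear (actN b).
Proof. by move=> a F G; apply/ffunP => g; rewrite !ffunE actr. Qed.

Lemma actN_ten b m x : actN b (ten m x) = ten (act b m) x.
Proof. by apply/ffunP => g; rewrite !ffunE (klZ (@actr b)). Qed.

Lemma sum_act_tau (A : algType K) (j : TB -> A) (H : 'I_d.-1 -> A) r m a :
  [ffun y => \sum_g act (pbw_coord j H a g) (tau h sM rM r g m y)] =
  eval_pbw j H actN (fun g => tau h sM rM r g m) a.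
Proof.
by apply/ffunP => y; rewrite ffunE sum_ffunE; apply: eq_bigr => g _; rewrite ffunE.
Qed.

Lemma ten_s1_inj i a1 a2 b1 b2 : ten a1 (h i * 1) + ten a2 1 = ten b1 (h i * 1) + ten b2 1 ->
  a1 = b1 /\ a2 = b2.
Proof.
have t1 m g : ten m (h i * 1) g = if g == s_ i then m else 0.
  by have := @ten_word m [:: i] g; rewrite /= mulg1 ninv_s1 // => ->.
have t2 m g : ten m 1 g = if g == 1%g then m else 0.
  by have := @ten_word m [::] g; rewrite /= ninv1 // => ->.
have s1 : (s_ i == 1%g) = false.
  by apply/eqP => e; have := ninv_s1 i; rewrite e ninv1.
have addE (F G : N) g : (F + G) g = F g + G g by rewrite ffunE.
move=> /ffunP e; split; [move: (e (s_ i)) | move: (e 1%g)].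
all: by rewrite !addE !t1 !t2 ?[1%g == s_ i]eq_sym !s1 !eqxx ?addr0 ?add0r.
Qed.

End Tau.

(** * Ground modules *)
Theorem theorem4p5
  (K : comPzRingType) (B : algType K) (hBfree : free_module B)
  (d : nat) (hd : (2 <= d)%N)
  (* B (x) B and B^{(x)d} *)
  (TB2 : lmodType K) (tB2 : ('I_2 -> B) -> TB2) (hTB2 : is_tensor_power tB2)
  (TB : lmodType K) (tB : ('I_d -> B) -> TB) (hTB : is_tensor_power tB)
  (S R : TB2) (sigma rho : TB2 -> TB2) (hsigma : klinear sigma) (hrho : klinear rho)
  (* the quantum wreath product B wr H(d), with PBW basis *)
  (A : algType K) (j : TB -> A) (H : 'I_d.-1 -> A)
  (hA : wreath_product tB tB2 S R sigma rho j H)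
  (* the twisted Hecke algebra *)
  (chiS chiR : K) (Ht : algType K) (h : 'I_d.-1 -> Ht)
  (hHt : twisted_hecke chiS chiR h)
  (* the left B-module M, M (x) M and M^{(x)d} *)
  (M : lmodType K) (actM : B -> M -> M) (hM : left_module actM)
  (TM2 : lmodType K) (tM2 : ('I_2 -> M) -> TM2) (hTM2 : is_tensor_power tM2)
  (TM : lmodType K) (tM : ('I_d -> M) -> TM) (hTM : is_tensor_power tM)
  (hS : forall m : TM2, tact tB2 tM2 actM S m = chiS *: m)
  (hR : forall m : TM2, tact tB2 tM2 actM R m = chiR *: m)
  (sigmaM rhoM : TM2 -> TM2) (hsigmaM : klinear sigmaM) (hrhoM : klinear rhoM) :
  let act := tact tB tM actM in
  let sig := onf tB tB2 sigma in
  let rh := onf tB tB2 rho in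
  let S_ := elt_i tB tB2 S in
  let R_ := elt_i tB tB2 R in
  let sM := onf tM tM2 sigmaM in
  let rM := onf tM tM2 rhoM in
  ground_module j H act h sM rM <->
  ((forall (i : 'I_d.-1) (b : TB) (m : TM),
      (* (M2) *)
      sM i (act b m) = act (sig i b) (sM i m) /\
      rM i (act b m) = act (sig i b) (rM i m) + act (rh i b) m) /\
   (forall (i : 'I_d.-1) (m : TM),
      (* (M4) *)
      chiS *: sM i (sM i m) + rM i (sM i m) + sM i (rM i m) = act (S_ i) (sM i m) /\
      chiR *: sM i (sM i m) + rM i (rM i m) = act (S_ i) (rM i m) + act (R_ i) m) /\
   ((3 <= d)%N ->
    forall (i k : 'I_d.-1), (val k = i.+1 \/ val i = k.+1) -> forall m : TM,
      (* (M5) *)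
      sM i (sM k (sM i m)) = sM k (sM i (sM k m)) /\
      rM i (sM k (sM i m)) = sM k (sM i (rM k m)) /\
      (* (M6) *)
      rM i (sM k (rM i m)) =
        chiS *: sM k (rM i (sM k m)) + rM k (rM i (sM k m)) + sM k (rM i (rM k m)) /\
      (* (M7) *)
      rM i (rM k (rM i m)) + chiR *: sM i (rM k (sM i m)) =
        rM k (rM i (rM k m)) + chiR *: sM k (rM i (sM k m)))).
Proof.
move=> act sig rh S_ R_ sM rM.
have actl : forall m, klinear (act^~ m) by move=> m; apply: act_linl.
have actr : forall b, klinear (act b) by move=> b; apply: act_linr.
have lsM i : klinear (sM i) by apply: onf_lin.
have lrM i : klinear (rM i) by apply: onf_lin.
have [[lj [j1 jM]] [Hbr Hcm] Hsq Hj pbw] := hA.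
set T := Tstep h sM rM.
have Tl : forall i, klinear (T i) := Tstep_lin h lsM lrM.
have Tt := Tstep_ten hHt lsM lrM.
pose N := {ffun 'S_d -> TM}.
have bl : forall F : N, klinear ((actN act)^~ F) := actN_linl actl.
have br : forall b, klinear (actN act b : N -> N) := actN_linr actr.
have one1 (F : N) : actN act (tB (fun _ => 1)) F = F.
  by apply/ffunP => g; rewrite ffunE; apply: (tact1 hM hTB hTM).
have bM b c : exists2 e, j e = j b * j c &
    forall F : N, actN act e F = actN act b (actN act c F).
  have [e je eE] := actM_mul hM hTB hTM lj jM b c; exists e => // F.
  by apply/ffunP => g; rewrite !ffunE; apply: eE.
split.
  case=> indep gm.
  split; last split.
  (* (M2) is the first identity at [w = s_i], read off at [h_i] and at 1. *)
  - move=> i b m; have [r cr ri] := choice_map_s1 i.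
    have [+ _] := gm r cr (s_ i) 1%g b m.
    (* The term [j (rh i b)] is written as [j (rh i b) * H_1], to be in PBW form. *)
    rewrite sum_act_tau (gword_s Hbr Hcm) Hj -(gword_s Hbr Hcm) -[X in _ + X]mulr1.
    rewrite -(gword1 Hbr Hcm) (klD (eval_pbw_lin lj pbw bl _)).
    rewrite !(eval_pbw_mono lj pbw bl) !(tauE hHt) ri (proj1 cr) /= !Tt.
    rewrite (klD (br _)) !(actN_ten h actr) -addrA -(klD (ten_linl _ _)).
    by case/(ten_s1_inj hHt).
  - move=> i m; have [r cr ri] := choice_map_s1 i.
    (* (M4) is the second identity at [w = x = s_i]; the value 0 fills [b], which occurs only in the
       first. *)
    have [_] := gm r cr (s_ i) (s_ i) 0 m.
    rewrite sum_act_tau (sum_rmulH_tau hHt lsM lrM) !(gword_s Hbr Hcm) Hsq.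
    rewrite -(gword_s Hbr Hcm) -[X in _ + X]mulr1.
    rewrite -(gword1 Hbr Hcm) (klD (eval_pbw_lin lj pbw bl _)).
    rewrite !(eval_pbw_mono lj pbw bl) !(tauE hHt) ri (proj1 cr) /=.
    rewrite (Tstep2_ten hHt lsM lrM) Tt.
    rewrite (klD (br _)) !(actN_ten h actr) -addrA -(klD (ten_linl _ _)).
    by case/(ten_s1_inj hHt).
  move=> _ i k ik m.
  have [r cr rE] := choice_map_s3 ik.
  have [r' cr' rE'] := choice_map_s3 (adjacent_sym ik).
  have := indep r r' cr cr' (s_ i * (s_ k * s_ i))%g m.
  rewrite !(tauE hHt) rE.
  have := s_braid 1 ik; rewrite !mulg1 => ->; rewrite rE' /=.
  by case/(Tstep3_inj hHt lsM lrM ik).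
case=> m2 [m4 m567].
have Tbr : braid T.
  apply: (Tstep_braid hHt lsM lrM) => i k ik m.
    by split; apply: onf_far => //; left.
  (* Two adjacent indices already occupy three tensor positions. *)
  have d3 : (3 <= d)%N.
    by have := ltn_ord i; have := ltn_ord k; move: ik; rewrite /adjacent; lia.
  by have [? [? [? ?]]] := m567 d3 i k ik m.
have T1 i m x : T i (ten h m x) = ten h (sM i m) (h i * x) + ten h (rM i m) x := Tt i m x.
have T2 i m x : T i (T i (ten h m x)) = _ := Tstep2_ten hHt lsM lrM i m x.
have Tsq i (F : N) : T i (T i F) = actN act (S_ i) (T i F) + actN act (R_ i) F.
  move: F; apply: (ten_ext hHt).
  - by apply: kl_comp; apply: Tl.
  - by move=> a F G; rewrite Tl !br !scalerDr addrACA.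
  move=> m x; rewrite T2 T1 (klD (br _)) !(actN_ten h actr).
  by have [-> ->] := m4 i m; rewrite -addrA -(klD (ten_linl _ _)).
have Tb i b (F : N) : T i (actN act b F) = actN act (sig i b) (T i F) + actN act (rh i b) F.
  move: F; apply: (ten_ext hHt).
  - by apply: kl_comp; [apply: Tl|apply: br].
  - by move=> a F G; rewrite Tl !br !scalerDr addrACA.
  move=> m x; rewrite T1 (klD (br _)) !(actN_ten h actr) T1.
  by have [-> ->] := m2 i b m; rewrite -addrA -(klD (ten_linl _ _)).
pose rp := rep j H (actN act) T.
have choice r w (F : N) : choice_map r -> foldr T F (r w) = foldr T F (rword w).
  move=> cr; have [/reducedP[e1 e2] _] := proj2 cr w; have [e3 e4] := rwordP w.
  by apply: matsumoto; rewrite ?e1 ?e3.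
have tau_rep r m a : choice_map r ->
    [ffun y => \sum_g act (pbw_coord j H a g) (tau h sM rM r g m y)] = rp a (ten h m 1).
  move=> cr; rewrite sum_act_tau; apply: eq_bigr => g _.
  by rewrite (tauE hHt) choice.
have repw w a F : rp (gword H w * a) F = foldr T (rp a F) (rword w).
  exact: (rep_gword lj pbw bl br j1 one1 Hbr Hcm bM Hsq Hj Tl Tbr Tsq Tb).
have repj b a F : rp (j b * a) F = actN act b (rp a F) by apply: (rep_j lj pbw bl br).
have rep1' F : rp 1 F = F by apply: (rep1 lj pbw bl j1 one1 Hbr Hcm).
split=> [r r' cr cr' w m | r cr w x b m]; first by rewrite !(tauE hHt) !choice.
(* On the vector [ten h m 1] the two identities now say that [rp] respects the products [H_w b] and
   [H_w H_x]. *)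
rewrite !(tau_rep r) // (sum_rmulH_tau hHt lsM lrM) !repw (tauE hHt) !choice //; split.
  by rewrite -[j b]mulr1 repj rep1' (actN_ten h actr).
by rewrite -[gword H x]mulr1 repw rep1' (tauE hHt) choice.
Qed.
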